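(* Let $M\ge 2$ be an integer and let $F\colon X\to X$ be the twisted baker map on $X=[-1,1]\times[0,1]^{M-1}$. Then $(F,m)$ is mixing; that is, for all Borel subsets $A$ and $B$ of $X$, $$\lim_{n\to\infty}m(A\cap F^{-n}(B))=m(A)\,m(B).$$
   Context: Let $M\ge2$ be an integer and $X=\{(x_1,\ldots,x_M)\in\mathbb R^M\colon -1\le x_1\le 1,\ 0\le x_j\le 1 \text{ for } j=2,\ldots,M\}$. Put $X_L=\{x\in X\colon x_1<0\}$ and $X_R=\{x\in X\colon x_1\ge 0\}$. The twisted baker map $F\colon X\to X$ is $$F(x_1,\ldots,x_M)=\begin{cases}(1+2x_1,x_2,\ldots,x_M) & \text{on } X_L,\\ (1-2x_M,x_1,\ldots,x_{M-1}) & \text{on } X_R.\end{cases}$$ $m$ denotes the normalized restriction of the Lebesgue measure of $\mathbb R^M$ to $X$ (so $m(X)=1$); it is an $F$-invariant measure. *)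

(* Defs.v *)
From HB Require Import structures.
From mathcomp Require Import all_boot all_order all_algebra.
From mathcomp Require Import all_classical all_reals all_analysis.
From mathcomp Require Import ring lra.

Set Implicit Arguments.
Unset Strict Implicit.
Unset Printing Implicit Defensive.
Import Order.TTheory GRing.Theory Num.Theory.
Import numFieldNormedType.Exports.

Local Open Scope classical_set_scope.
Local Open Scope ring_scope.

(* The measurable structure of [n.-tuple T] is the sigma-algebra generated by
   the coordinates: here, the Borel sigma-algebra of R^n.
   The type [measurableTypeR R] is [R] with its Borel sigma-algebra, on which
   [lebesgue_measure] is defined. *)
Notation Rtuple R n := (n.-tuple (measurableTypeR R)).

Section lebesgue_cons.
Local Open Scope ereal_scope.
Context {R : realType} (n : nat).
Variable mu : {sigma_finite_measure set (Rtuple R n) -> \bar R}.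

Definition tuple_cons (p : measurableTypeR R * Rtuple R n) : Rtuple R n.+1 :=
  [tuple of p.1 :: p.2].

Lemma measurable_tuple_cons : measurable_fun [set: _] tuple_cons.
Proof. by apply: measurable_cons. Qed.

Definition lebesgue_cons : set (Rtuple R n.+1) -> \bar R :=
  pushforward (lebesgue_measure \x mu) tuple_cons.

Let lebesgue_cons0 : lebesgue_cons set0 = 0.
Proof. by rewrite /lebesgue_cons /pushforward preimage_set0 measure0. Qed.

Let lebesgue_cons_ge0 A : 0 <= lebesgue_cons A.
Proof. by rewrite /lebesgue_cons /pushforward; apply: measure_ge0. Qed.

Let lebesgue_cons_sigma_additive : semi_sigma_additive lebesgue_cons.
Proof.
exact: (@measure_semi_sigma_additive _ _ _
  (measure_function_pushforward__canonical__measure_function_Measure _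
    measurable_tuple_cons)).
Qed.

HB.instance Definition _ := isMeasure.Build _ _ _ lebesgue_cons
  lebesgue_cons0 lebesgue_cons_ge0 lebesgue_cons_sigma_additive.

Let tuple_uncons (t : Rtuple R n.+1) : measurableTypeR R * Rtuple R n :=
  (thead t, [tuple of behead t]).

Let tuple_consK : cancel tuple_cons tuple_uncons.
Proof. by case=> x t; congr pair; exact: val_inj. Qed.

Let measurable_tuple_uncons : measurable_fun [set: _] tuple_uncons.
Proof.
apply/measurable_fun_pairP; split; first exact: measurable_tnth.
exact: measurable_behead.
Qed.

Let lebesgue_cons_sigma_finite : sigma_finite setT lebesgue_cons.
Proof.
have /sigma_finiteP[F [TF ndF Foo]] :=
  sigma_finiteT (@lebesgue_measure R : {sigma_finite_measure set _ -> \bar R}).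
have /sigma_finiteP[G [TG ndG Goo]] := sigma_finiteT mu.
exists (fun k => tuple_uncons @^-1` (F k `*` G k)) => [|k].
  rewrite -preimage_bigcup (_ : \bigcup_k _ = setT) ?preimage_setT//.
  rewrite -setXTT TF TG predeqE => -[x y]; split.
    by move=> [k _ []] Fkx Gky; split; exists k.
  move=> [/= [k _ Fkx] [l _ Gly]]; exists (maxn k l) => //; split.
  - by move: x Fkx; exact/subsetPset/ndF/leq_maxl.
  - by move: y Gly; exact/subsetPset/ndG/leq_maxr.
have [mF Fk] := Foo k; have [mG Gk] := Goo k; split.
  rewrite -[X in measurable X]setTI; apply: measurable_tuple_uncons => //.
  exact: measurableX.
rewrite /lebesgue_cons /pushforward -comp_preimage.
rewrite (_ : _ \o _ = id) ?preimage_id.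
  by rewrite product_measure1E// lte_mul_pinfty// ge0_fin_numE.
by apply/funext => p /=; rewrite tuple_consK.
Qed.

HB.instance Definition _ := Measure_isSigmaFinite.Build _ _ _ lebesgue_cons
  lebesgue_cons_sigma_finite.

End lebesgue_cons.

(* Lebesgue measure on the Borel sets of R^n, as an iterated product measure;
   [lebesgue_tuple_box] gives its value on boxes. *)
Fixpoint lebesgue_tuple (R : realType) (n : nat) :
    {sigma_finite_measure set (Rtuple R n) -> \bar R} :=
  match n with
  | 0 => \d_([tuple] : Rtuple R 0)
  | m.+1 => lebesgue_cons (lebesgue_tuple R m)
  end.

Lemma lebesgue_tuple_box (R : realType) (n : nat)
    (A : 'I_n -> set (measurableTypeR R)) : (forall i, measurable (A i)) ->
  lebesgue_tuple R n [set x | forall i, A i (tnth x i)] =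
  (\prod_(i < n) lebesgue_measure (A i))%E.
Proof.
elim: n A => [|n IHn] A mA.
  by rewrite big_ord0 /= diracE mem_set//= => -[].
rewrite big_ord_recl -IHn//= /lebesgue_cons /pushforward.
rewrite -product_measure1E//; last first.
  rewrite (_ : mkset _ =
    \bigcap_(i in [set: 'I_n]) (fun x => tnth x i) @^-1` A (lift ord0 i)).
    apply: fin_bigcap_measurable => // i _.
    by rewrite -[X in measurable X]setTI; exact: measurable_tnth.
  by apply/seteqP; split=> x /= Ax i; [move=> _|]; exact: Ax.
congr (_ \x _)%E; apply/seteqP; split=> -[a t] /=.
  move=> At; split; first exact: (At ord0).
  by move=> i; have := At (lift ord0 i); rewrite tnthS.
move=> [Aa At] i; case: (unliftP ord0 i) => [j|] ->; last exact: Aa.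
by rewrite tnthS.
Qed.

Section twisted_baker.
Context (R : realType) (M : nat).

(* The first coordinate, ranging in [-1, 1], has index 0. *)
Definition baker_space : set (Rtuple R M) :=
  [set x | forall i : 'I_M,
     (if i == 0%N :> nat then -1 else 0) <= (tnth x i : R) <= 1].

(* Points outside [baker_space] get arbitrary values; [x`_0] and [x`_M.-1] are
   the first and last coordinates. *)
Definition twisted_baker (x : Rtuple R M) : Rtuple R M :=
  if (x`_0 : R) < 0
  then [tuple if i == 0%N :> nat then 1 + 2 * (x`_0 : R) else x`_i | i < M]
  else [tuple if i == 0%N :> nat then 1 - 2 * (x`_M.-1 : R) else x`_i.-1
       | i < M].

Lemma twisted_baker_stable x : baker_space x -> baker_space (twisted_baker x).
Proof.
move=> Xx i; have M0 : (0 < M)%N by case: M i => [[]|].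
have Xn k : (k < M)%N -> (if k == 0%N then -1 else 0) <= (x`_k : R) <= 1.
  by move=> kM; have := Xx (Ordinal kM); rewrite (tnth_nth 0).
have Xn0 k : (k < M)%N -> 0 <= (x`_0 : R) -> 0 <= (x`_k : R) <= 1.
  move=> kM x0; have /andP[xk ->] := Xn k kM; rewrite andbT.
  by move: xk; case: eqVneq => [->|].
have /andP[] /= := Xn 0%N M0; rewrite /twisted_baker.
move: (x`_0 : R) Xn0 => x0 Xn0 x0_ge x0_le.
case: ltP => x0_0; rewrite tnth_mktuple; case: ifPn => i0.
- lra.
- by have := Xn _ (ltn_ord i); rewrite (negbTE i0).
- have /andP[] := Xn0 M.-1 (eq_ind_r is_true M0 (ltn_predL M)) x0_0.
  by move: (x`_M.-1 : R) => y y0 y1; lra.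
- have /andP[xi ->] := Xn0 i.-1 (leq_ltn_trans (leq_pred i) (ltn_ord i)) x0_0.
  by rewrite andbT.
Qed.

Let baker_side (i : 'I_M) : set (measurableTypeR R) :=
  `[(if i == 0%N :> nat then -1 else 0 : R), 1]%classic.

Let baker_spaceE : baker_space = [set x | forall i, baker_side i (tnth x i)].
Proof.
by apply/seteqP; split=> x /= Xx i; have := Xx i; rewrite /baker_side /= in_itv.
Qed.

Lemma measurable_baker_space : measurable baker_space.
Proof.
rewrite (_ : baker_space =
  \bigcap_(i in [set: 'I_M]) (fun x => tnth x i) @^-1` baker_side i).
  apply: fin_bigcap_measurable => // i _.
  rewrite -[X in measurable X]setTI; apply: measurable_tnth => //.
  exact: measurable_itv.
by rewrite baker_spaceE; apply/seteqP; split=> x /= Xx i; [move=> _|]; exact: Xx.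
Qed.

(* The second argument of [mnormalize] is a default value used for measures of
   total mass 0 or +oo: it is irrelevant here, see [baker_measureE]. *)
Definition baker_measure : probability (Rtuple R M) R :=
  mnormalize (mrestr (lebesgue_tuple R M) measurable_baker_space)
    \d_([tuple of nseq M (0 : R)] : Rtuple R M).

Lemma lebesgue_baker_space : (0 < M)%N ->
  lebesgue_tuple R M baker_space = 2%:E.
Proof.
move=> M0; rewrite baker_spaceE lebesgue_tuple_box; last first.
  by move=> i; exact: measurable_itv.
rewrite (bigD1 (Ordinal M0))//= big1 ?mule1 => [|i i0].
  by rewrite lebesgue_measure_itv /= lte_fin gtrN // -EFinB; congr EFin; lra.
by rewrite /baker_side ifN// lebesgue_measure_itv /= lte_fin ltr01 sube0.
Qed.

Lemma baker_measureE (A : set (Rtuple R M)) : (0 < M)%N ->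
  baker_measure A = (lebesgue_tuple R M (A `&` baker_space) * 2^-1%:E)%E.
Proof.
move=> M0; pose mu := mrestr (lebesgue_tuple R M) measurable_baker_space.
have muT : mu setT = 2%:E by rewrite /mu /mrestr setTI lebesgue_baker_space.
have mnormalizeE d (T : measurableType d) (nu : {measure set T -> \bar R})
    (P : probability T R) (B : set T) : nu setT = 2%:E ->
    mnormalize nu P B = (nu B * 2^-1%:E)%E.
  by move=> nuT; rewrite /mnormalize nuT eqe pnatr_eq0.
exact: mnormalizeE muT.
Qed.

End twisted_baker.

(* [f] stands for a self-map of [X]: as [A] lies in [X], the part of the
   preimage of [B] outside [X] plays no role. *)
Definition mixing d (T : measurableType d) (R : realType) (X : set T)
    (mu : set T -> \bar R) (f : T -> T) :=
  forall A B : set T, measurable A -> measurable B -> A `<=` X -> B `<=` X ->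
  mu (A `&` iter n f @^-1` B) @[n --> \oo] --> (mu A * mu B)%E.

(* Main.v *)
Require Import Defs.
From mathcomp Require Import all_boot all_order all_algebra.
From mathcomp Require Import all_classical all_reals all_analysis.
From mathcomp Require Import measurable_realfun ring lra.

(* The map F has two full inverse branches g0, g1 with constant Jacobian 1/2, so
   2 m(A) = m(g0^-1 A) + m(g1^-1 A), and the transfer operator
   L f = (f o g0 + f o g1) / 2 satisfies
   int f (1_B o F^n) dm = int (L^n f) 1_B dm.
   The branch g0 only contracts the first coordinate and g1 is a twisted
   rotation of the coordinates, so neither is a contraction; but for the
   weighted l^1 distance d(x, y) = sum_i (M + i) |x_i - y_i|,
   i = 0, ..., M - 1, they contract on average:
   d(g0 x, g0 y) + d(g1 x, g1 y) <= 2 (1 - 1 / (4 M)) d(x, y).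
   Hence L^n f converges uniformly on X to the constant int f dm when f is
   d-Lipschitz, which is mixing against f.  Indicators are L^1 limits of
   Lipschitz functions: the sets with this property form a sigma-algebra
   containing the half-spaces {x_i > c}. *)

Set Implicit Arguments.
Unset Strict Implicit.
Unset Printing Implicit Defensive.
Import Order.TTheory GRing.Theory Num.Theory.
Import numFieldNormedType.Exports.

Local Open Scope classical_set_scope.
Local Open Scope ring_scope.

(** * Bounded measurable functions and their integrals against a probability *)

Section bounded_measurable.
Context d (T : measurableType d) (R : realType).
Implicit Types (f g : T -> R) (A : set T).

(** Boundedness is required everywhere, not almost everywhere: the class is then stable under
    composition with measurable maps, and its members are integrable for every probability. *)
Definition bmfun f := measurable_fun setT f /\ exists C, forall x, `|f x| <= C.

Lemma bmfun_unit f : measurable_fun setT f -> (forall x, 0 <= f x <= 1) ->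
  bmfun f.
Proof.
move=> mf f01; split=> //; exists 1 => x.
by have := f01 x; rewrite ler_norml; lra.
Qed.

Lemma bmfun_cst (c : R) : bmfun (fun=> c).
Proof. by split; [exact: measurable_cst|exists `|c|]. Qed.

Lemma bmfun_indic A : measurable A -> bmfun \1_A.
Proof.
move=> mA; apply: bmfun_unit; first exact: measurable_indic.
by move=> x; rewrite indicE; case: (_ \in _) => /=; lra.
Qed.

Lemma bmfunD f g : bmfun f -> bmfun g -> bmfun (fun x => f x + g x).
Proof.
move=> [mf [C fC]] [mg [D gD]]; split; first exact: measurable_funD.
by exists (C + D) => x; apply: le_trans (ler_normD _ _) _; exact: lerD.
Qed.

Lemma bmfunB f g : bmfun f -> bmfun g -> bmfun (fun x => f x - g x).
Proof.
move=> [mf [C fC]] [mg [D gD]]; split; first exact: measurable_funB.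
by exists (C + D) => x; apply: le_trans (ler_normB _ _) _; exact: lerD.
Qed.

Lemma bmfunM f g : bmfun f -> bmfun g -> bmfun (fun x => f x * g x).
Proof.
move=> [mf [C fC]] [mg [D gD]]; split; first exact: measurable_funM.
by exists (C * D) => x; rewrite normrM ler_pM.
Qed.

Lemma bmfun_norm f : bmfun f -> bmfun (fun x => `|f x|).
Proof.
move=> [mf [C fC]]; split; first exact: measurableT_comp.
by exists C => x; rewrite normr_id.
Qed.

Lemma bmfun_comp f (g : T -> T) : bmfun f -> measurable_fun setT g ->
  bmfun (f \o g).
Proof.
move=> [mf [C fC]] mg; split; first exact: measurableT_comp.
by exists C => x; exact: fC.
Qed.

Variable P : probability T R.

Lemma bmfun_integrable f : bmfun f -> P.-integrable setT (EFin \o f).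
Proof.
move=> [mf [C fC]]; apply: measurable_bounded_integrable => //.
  exact: le_lt_trans (probability_le1 P measurableT) (ltry 1).
exists C; split; first exact: num_real.
by move=> x Cx y _; apply: le_trans (fC y) (ltW Cx).
Qed.

Lemma Rintegral_cst_probability (c : R) : \int[P]_x c = c.
Proof.
rewrite Rintegral_cst//; have /= -> := probability_setT P.
by rewrite mulr1.
Qed.

Lemma Rintegral_indic A : measurable A ->
  \int[P]_x (\1_A x : R) = fine (P A).
Proof. by move=> mA; rewrite /Rintegral integral_indic// setIT. Qed.

Lemma Rintegral_ae_eq f g : bmfun f -> bmfun g ->
  {ae P, forall x, f x = g x} -> \int[P]_x f x = \int[P]_x g x.
Proof.
move=> [mf _] [mg _] fg; congr fine; apply: ae_eq_integral => //.
- exact/measurable_EFinP.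
- exact/measurable_EFinP.
- by apply: filterS fg => x /= -> _.
Qed.

Lemma Rintegral_ae_bound f c : bmfun f -> 0 <= c ->
  {ae P, forall x, `|f x| <= c} -> `|\int[P]_x f x| <= c.
Proof.
move=> bf c0 fc.
apply: (le_trans (le_normr_Rintegral measurableT (bmfun_integrable bf))).
(* Monotonicity of the integral asks for a pointwise bound, so [|f|] is replaced by its truncation
   at [c], which agrees with it almost everywhere. *)
pose h x := Num.min `|f x| c.
have bh : bmfun h.
  have [mf _] := bf; split; last first.
    exists c => x.
    by rewrite /h ger0_norm ?ge_min ?lexx ?orbT// le_min normr_ge0.
  by apply: measurable_minr => //; exact: measurableT_comp.
rewrite (@Rintegral_ae_eq _ h)//; last 2 first.
- exact: bmfun_norm.
- by apply: filterS fc => x fx; rewrite /h; apply/esym/min_idPl.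
rewrite -[leRHS]Rintegral_cst_probability.
apply: le_Rintegral => //; try exact: bmfun_integrable.
  exact/bmfun_integrable/bmfun_cst.
by move=> x _; rewrite /h ge_min lexx orbT.
Qed.

End bounded_measurable.

(** * Sets whose indicators are L^1 limits of Lipschitz functions *)

Section approximable.
Context d (T : measurableType d) (R : realType) (P : probability T R).
Variable dist : T -> T -> R.

Definition dlip (K : R) (f : T -> R) :=
  forall x y, `|f x - f y| <= K * dist x y.

(** Values in [0, 1] make the approximants bounded and nonnegative, as [decorrelation] requires, and
    survive the operations [1 - f] and [max] that handle complements and unions. *)
Definition approximable (A : set T) := measurable A /\
  forall e : R, 0 < e -> exists f : T -> R,
    [/\ measurable_fun setT f, forall x, 0 <= f x <= 1,
        exists2 K, 0 <= K & dlip K f & \int[P]_x `|\1_A x - f x| <= e].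

Lemma approximable_err A (f : T -> R) : measurable A -> measurable_fun setT f ->
  (forall x, 0 <= f x <= 1) -> bmfun (fun x => `|(\1_A x : R) - f x|).
Proof.
move=> mA mf f01; apply/bmfun_norm/bmfunB; first exact: bmfun_indic.
exact: bmfun_unit.
Qed.

Lemma approximable0 : approximable set0.
Proof.
split=> // e e0; exists (fun=> 0); split => //.
- by move=> x; rewrite lexx ler01.
- by exists 0 => // x y; rewrite subrr normr0 mul0r.
- under eq_Rintegral do rewrite indic0 subrr normr0.
  by rewrite Rintegral_cst_probability ltW.
Qed.

Lemma approximableC A : approximable A -> approximable (~` A).
Proof.
move=> [mA aA]; split=> [|e e0]; first exact: measurableC.
have [f [mf f01 [K K0 fK] fe]] := aA e e0.
exists (fun x => 1 - f x); split.
- exact: measurable_funB.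
- by move=> x; have := f01 x; lra.
- by exists K => // x y; rewrite (_ : _ - _ = - (f x - f y)) ?normrN//; ring.
- under eq_Rintegral => x _.
    rewrite indicC (_ : _ - _ = - (\1_A x - f x)) ?normrN; last first.
      by rewrite indicE; case: (x \in A) => /=; ring.
    over.
  exact: fe.
Qed.

(** Serves twice in [approximableU]: for the Lipschitz constant of a maximum and, the indicator of a
    union being the maximum of the indicators, for its L^1 error. *)
Lemma normr_max_sub (a b u v : R) :
  `|Num.max a b - Num.max u v| <= `|a - u| + `|b - v|.
Proof.
have := ler_norm (a - u); have : u - a <= `|a - u| by rewrite distrC ler_norm.
have := ler_norm (b - v); have : v - b <= `|b - v| by rewrite distrC ler_norm.
by rewrite ler_norml !maxEle; case: ifPn; case: ifPn; rewrite -?ltNge; lra.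
Qed.

Lemma approximableU A B : approximable A -> approximable B ->
  approximable (A `|` B).
Proof.
move=> [mA aA] [mB aB]; split=> [|e e0]; first exact: measurableU.
have e20 : 0 < e / 2 by lra.
have [f [mf f01 [K K0 fK] fe]] := aA _ e20.
have [g [mg g01 [L L0 gL] ge]] := aB _ e20.
have mfg : measurable_fun setT (fun x => Num.max (f x) (g x)).
  exact: measurable_maxr.
have fg01 x : 0 <= Num.max (f x) (g x) <= 1.
  by have := f01 x; have := g01 x; rewrite maxEle; case: ifPn; lra.
exists (fun x => Num.max (f x) (g x)); split => //.
- exists (K + L) => [|x y]; first exact: addr_ge0.
  by apply: le_trans (normr_max_sub _ _ _ _) _; rewrite mulrDl lerD.
- apply: (@le_trans _ _
    (\int[P]_x (`|\1_A x - f x| + `|\1_B x - g x|))); last first.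
    rewrite RintegralD//; try exact/bmfun_integrable/approximable_err.
    by lra.
  apply: le_Rintegral => //.
  + exact/bmfun_integrable/approximable_err/fg01/mfg/measurableU.
  + by apply/bmfun_integrable/bmfunD; exact: approximable_err.
  + move=> x _; rewrite (_ : \1_(A `|` B) x = Num.max (\1_A x) (\1_B x) :> R).
      exact: normr_max_sub.
    rewrite !indicE in_setU.
    do 2 case: (_ \in _) => /=;
      by rewrite ?maxxx// ?(max_l ler01) ?(max_r ler01).
Qed.

Lemma approximable_bigsetU (A : (set T)^nat) n :
  (forall k, approximable (A k)) ->
  approximable (\big[setU/set0]_(k < n) A k).
Proof.
move=> aA; elim/big_ind : _ => //; first exact: approximable0.
exact: approximableU.
Qed.

(** Continuity of the measure from above. It is applied to the remainders of a countable union and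
    to thin layers above a level of a function. *)
Lemma nonincreasing_small_measure (F : (set T)^nat) (e : R) :
  (forall n, measurable (F n)) -> nonincreasing_seq F ->
  \bigcap_n F n = set0 -> 0 < e -> exists n, fine (P (F n)) < e.
Proof.
move=> mF niF F0 e0.
have : P \o F @ \oo --> P (\bigcap_n F n).
  apply: nonincreasing_cvg_mu => //; last by rewrite F0.
  exact: le_lt_trans (probability_le1 P (mF 0%N)) (ltry 1).
rewrite F0 measure0 => /fine_cvgP[_ /cvgrPdist_lt/(_ _ e0)[n _ /(_ n)]] /=.
rewrite leqnn sub0r normrN => /(_ isT) Fn; exists n.
by apply: le_lt_trans Fn; exact: ler_norm.
Qed.

(** A finite subunion [B n] exhausts the union up to measure [e / 2], and an approximant of [B n]
    within [e / 2] then serves for the whole union. *)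
Lemma approximable_bigcup (A : (set T)^nat) : (forall k, approximable (A k)) ->
  approximable (\bigcup_k A k).
Proof.
move=> aA; have mA k : measurable (A k) by have [] := aA k.
have mU : measurable (\bigcup_k A k) by exact: bigcup_measurable.
split=> // e e0; have e20 : 0 < e / 2 by lra.
pose B n := \big[setU/set0]_(k < n) A k.
have mB n : measurable (B n) by exact: bigsetU_measurable.
have BU n : B n `<=` \bigcup_k A k.
  by rewrite /B -bigcup_mkord; apply: bigcup_sub => k _; exact: bigcup_sup.
have [n Pn] : exists n, fine (P (\bigcup_k A k `\` B n)) < e / 2.
  apply: nonincreasing_small_measure => //.
  - by move=> n; exact: measurableD.
  - move=> m n mn; apply/subsetPset; apply: setDS; rewrite /B -!bigcup_mkord.
    apply: bigcup_sub => k /= km; apply: bigcup_sup => /=.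
    exact: leq_trans mn.
  - apply/seteqP; split=> // x /= xF; have [[k _ Akx] _] := xF 0%N I.
    (* [B n] collects the indices below [n], so a point of [A k] has left the remainder at index
       [k.+1]. *)
    have [_] := xF k.+1 I; apply; rewrite /B -bigcup_mkord.
    by exists k => /=.
have [f [mf f01 [K K0 fK] fe]] := (approximable_bigsetU n aA).2 _ e20.
exists f; split=> //; first by exists K.
apply: (@le_trans _ _
  (\int[P]_x (`|\1_(B n) x - f x| + \1_(\bigcup_k A k `\` B n) x))).
  apply: le_Rintegral => //.
  - exact/bmfun_integrable/approximable_err.
  - apply/bmfun_integrable/bmfunD; first exact: approximable_err.
    exact/bmfun_indic/measurableD.
  - move=> x _; rewrite !indicE in_setD.
    have [xB|xB] /= := boolP (x \in B n).
      by rewrite (mem_set (BU n _ (set_mem xB))) addr0.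
    rewrite sub0r normrN andbT; have /andP[f0 f1] := f01 x.
    case: (x \in \bigcup_k A k) => /=; first by rewrite !ger0_norm; lra.
    by rewrite sub0r normrN addr0.
rewrite RintegralD//.
- by rewrite Rintegral_indic; [lra|exact: measurableD].
- exact/bmfun_integrable/approximable_err.
- exact/bmfun_integrable/bmfun_indic/measurableD.
Qed.

(** The approximant is a ramp of slope [n.+1] in [phi], clamped to [0, 1]. It differs from the
    indicator only on the layer [F n], where [phi] exceeds [a] by less than 1 / (n + 1), and these
    layers decrease to the empty set. *)
Lemma approximable_superlevel (phi : T -> R) (K a : R) :
  measurable_fun setT phi -> 0 <= K -> dlip K phi ->
  approximable [set x | a < phi x].
Proof.
move=> mphi K0 phiK.
have mA (c : R) : measurable [set x | c < phi x].
  rewrite (_ : mkset _ = phi @^-1` `]c, +oo[%classic); last first.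
    by apply/seteqP; split=> x /=; rewrite in_itv/= andbT.
  by rewrite -[X in measurable X]setTI; apply: mphi.
split=> // e e0.
pose F n := [set x | 0 < phi x - a < n.+1%:R^-1].
have mF n : measurable (F n).
  rewrite (_ : F n = phi @^-1` `]a, (a + n.+1%:R^-1)[%classic).
    by rewrite -[X in measurable X]setTI; apply: mphi.
  by apply/seteqP; split=> x /=; rewrite /F in_itv/= subr_gt0 ltrBlDl.
have [n Pn] : exists n, fine (P (F n)) < e.
  apply: nonincreasing_small_measure => //.
  - move=> m n mn; apply/subsetPset => x; rewrite /F /=.
    move=> /andP[-> /=] /lt_le_trans; apply.
    by rewrite lef_pV2 ?posrE ?ltr0n// ler_nat ltnS.
  - apply/seteqP; split=> // x /= xF; have /andP[x0 _] := xF 0%N I.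
    have [n] := ltr_add_invr x0.
    rewrite add0r => nx; have /andP[_] := xF n I.
    by rewrite ltNge (ltW nx).
pose f x := Num.min 1 (Num.max 0 (n.+1%:R * (phi x - a))).
have mf : measurable_fun setT f.
  apply: measurable_minr => //; apply: measurable_maxr => //.
  by apply: measurable_funM => //; exact: measurable_funB.
have f01 x : 0 <= f x <= 1.
  by rewrite /f minEle maxEle; do 2 case: ifPn; rewrite -?ltNge; lra.
have n0 : 0 < n.+1%:R :> R by rewrite ltr0n.
exists f; split=> //.
- exists (n.+1%:R * K) => [|x y]; first by rewrite mulr_ge0// ltW.
  (* Clamping to [0, 1] does not increase distances. *)
  apply: (@le_trans _ _ `|n.+1%:R * (phi x - a) - n.+1%:R * (phi y - a)|).
    rewrite /f; move: (n.+1%:R * _) (n.+1%:R * (phi y - a)) => u v.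
    have := ler_norm (u - v).
    have : v - u <= `|u - v| by rewrite distrC ler_norm.
    rewrite ler_norml !minEle !maxEle.
    by do 4 case: ifPn; rewrite -?ltNge; lra.
  rewrite -mulrBr opprB addrA subrK normrM (ger0_norm (ltW n0)) -mulrA.
  by rewrite (ler_wpM2l (ltW n0)).
(* The error is at most 1 on the layer and 0 elsewhere. *)
- apply: (@le_trans _ _ (\int[P]_x \1_(F n) x)); last first.
    by rewrite Rintegral_indic// ltW.
  apply: le_Rintegral => //.
  + exact/bmfun_integrable/approximable_err.
  + exact/bmfun_integrable/bmfun_indic.
  + move=> x _; rewrite !indicE.
    have [xA|xA] := boolP (x \in [set x | a < phi x]).
      have [xF|xF] := boolP (x \in F n).
        by have /andP[f0 f1] := f01 x; rewrite /= ger0_norm; lra.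
      rewrite /f; move: xF; rewrite notin_setE /F /= => /negP.
      move: xA; rewrite inE /= subr_gt0 => -> /=; rewrite -leNgt => xn.
      have : 1 <= n.+1%:R * (phi x - a) by rewrite -ler_pdivrMl// mulr1.
      move: (n.+1%:R * _) => u u1.
      by rewrite (max_r (le_trans ler01 u1)) (min_l u1) subrr normr0.
    suff -> : f x = 0 by rewrite subrr normr0.
    move: xA; rewrite notin_setE /= => /negP; rewrite -leNgt -subr_le0 => xa.
    rewrite /f max_l; first by rewrite min_r.
    by rewrite pmulr_rle0.
Qed.

(** The closure properties above make the approximable sets a sigma-algebra, so generators
    suffice. *)
Lemma measurable_approximable (G : set (set T)) :
  measurable `<=` <<s G >> -> G `<=` approximable ->
  forall A, measurable A -> approximable A.
Proof.
move=> mG Ga A /mG; apply: smallest_sub => //; split.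
- exact: approximable0.
- by move=> B aB; rewrite setTD; exact: approximableC.
- exact: approximable_bigcup.
Qed.

End approximable.

(** * Mixing for a map whose two inverse branches contract on average *)

Section two_branches.
Context d (T : measurableType d) (R : realType) (P : probability T R).
Variables (F g0 g1 : T -> T) (dist : T -> T -> R) (X : set T) (lam D : R).
Hypothesis mF : measurable_fun setT F.
Hypothesis mg0 : measurable_fun setT g0.
Hypothesis mg1 : measurable_fun setT g1.
Hypothesis P_branches : forall A, measurable A ->
  (2%:E * P A = P (g0 @^-1` A) + P (g1 @^-1` A))%E.
Hypothesis g0K : {ae P, forall x, F (g0 x) = x}.
Hypothesis g1K : {ae P, forall x, F (g1 x) = x}.
Hypothesis lam01 : 0 <= lam < 1.
Hypothesis dist_contract : forall x y,
  dist (g0 x) (g0 y) + dist (g1 x) (g1 y) <= 2 * lam * dist x y.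
Hypothesis PX : {ae P, forall x, X x}.
Hypothesis X0 : X !=set0.
Hypothesis distX : forall x y, X x -> X y -> dist x y <= D.
Implicit Types (f : T -> R) (A B : set T).

Definition transfer f : T -> R := fun x => (f (g0 x) + f (g1 x)) / 2.

Lemma bmfun_transfer f : bmfun f -> bmfun (transfer f).
Proof.
move=> bf; apply: bmfunM; last exact: bmfun_cst.
by apply: bmfunD; apply: (bmfun_comp bf).
Qed.

(** Only the sum of the two branch distances is controlled, and the average over the branches sees
    nothing else; the 2 in [dist_contract] cancels the halving in [transfer]. *)
Lemma dlip_transfer K f : 0 <= K -> dlip dist K f ->
  dlip dist (lam * K) (transfer f).
Proof.
move=> K0 fK x y; rewrite /transfer -mulrBl normrM.
rewrite [X in _ * X]ger0_norm ?invr_ge0// ler_pdivrMr//.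
rewrite (_ : _ - _ = (f (g0 x) - f (g0 y)) + (f (g1 x) - f (g1 y))); last ring.
apply: le_trans (ler_normD _ _) _.
apply: le_trans (lerD (fK _ _) (fK _ _)) _.
rewrite -mulrDr (_ : _ * 2 = K * (2 * lam * dist x y)); last ring.
exact: ler_wpM2l.
Qed.

Lemma dlip_iter_transfer K f n : 0 <= K -> dlip dist K f ->
  dlip dist (lam ^+ n * K) (iter n transfer f).
Proof.
move=> K0 fK; elim: n => [|n IH]; first by rewrite mul1r.
rewrite exprS -mulrA; apply: dlip_transfer => //.
by rewrite mulr_ge0// exprn_ge0//; case/andP: lam01.
Qed.

(** By [P_branches], 2 P is the sum of the images of P under the two branches; this is the
    integrated form. Nonnegativity of [f] allows the computation in the extended reals, and
    boundedness brings it back to the reals. *)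
Lemma Rintegral_branches f : bmfun f -> (forall x, 0 <= f x) ->
  2 * \int[P]_x f x = \int[P]_x f (g0 x) + \int[P]_x f (g1 x).
Proof.
move=> bf f0.
pose P0 : {measure set T -> \bar R} :=
  measure_function_pushforward__canonical__measure_function_Measure P mg0.
pose P1 : {measure set T -> \bar R} :=
  measure_function_pushforward__canonical__measure_function_Measure P mg1.
have mf : measurable_fun setT (EFin \o f) by have [/measurable_EFinP] := bf.
have f0E x : [set: T] x -> (0 <= (EFin \o f) x)%E by move=> _; rewrite lee_fin.
have : (\int[mscale (NngNum (ler0n R 2)) P]_x (f x)%:E =
        \int[measure_add P0 P1]_x (f x)%:E)%E.
  apply: eq_measure_integral => A mA _.
  exact: etrans (P_branches mA) (esym (measure_addE P0 P1 A)).
rewrite ge0_integral_mscale// ge0_integral_measure_add//.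
have -> : (\int[P0]_x (f x)%:E = \int[P]_x (f (g0 x))%:E)%E.
  by rewrite ge0_integral_pushforward// => x /set_mem; exact: f0E.
have -> : (\int[P1]_x (f x)%:E = \int[P]_x (f (g1 x))%:E)%E.
  by rewrite ge0_integral_pushforward// => x /set_mem; exact: f0E.
have fin h : bmfun h -> (\int[P]_x (h x)%:E \is a fin_num)%E.
  by move=> bh; apply: integrable_fin_num => //; exact: bmfun_integrable.
move=> /(congr1 fine) E; apply: etrans (etrans E _).
  by apply/esym; apply: fineM => //; exact: fin.
by apply: fineD; apply: fin; apply: (bmfun_comp bf).
Qed.

Lemma measurable_iter n : measurable_fun setT (iter n F).
Proof.
elim: n => [|n IH]; first exact: measurable_id.
exact: (measurableT_comp mF IH).
Qed.

Lemma measurable_iter_preimage n B : measurable B ->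
  measurable (iter n F @^-1` B).
Proof.
by move=> mB; rewrite -[X in measurable X]setTI; exact: measurable_iter.
Qed.

(** Duality between composition with F and [transfer], by induction on [n] for all [f] at once.
    [Rintegral_branches] splits the left side over the branches; there F undoes the branch almost
    everywhere, which removes one iterate of F. *)
Lemma Rintegral_iter_transfer n f B : bmfun f -> (forall x, 0 <= f x) ->
  measurable B ->
  \int[P]_x (f x * \1_(iter n F @^-1` B) x) =
  \int[P]_x (iter n transfer f x * \1_B x).
Proof.
elim: n f => [//|n IH] f bf f0 mB.
have mS := measurable_iter_preimage n.+1 mB.
have mn := measurable_iter_preimage n mB.
have bh : bmfun (fun x => f x * \1_(iter n.+1 F @^-1` B) x).
  by apply: bmfunM => //; exact: bmfun_indic.
have h0 x : 0 <= f x * \1_(iter n.+1 F @^-1` B) x :> R.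
  by rewrite mulr_ge0// indicE.
have branch g : measurable_fun setT g -> {ae P, forall x, F (g x) = x} ->
    \int[P]_x (f (g x) * \1_(iter n.+1 F @^-1` B) (g x)) =
    \int[P]_x (f (g x) * \1_(iter n F @^-1` B) x).
  move=> mg gK; apply: Rintegral_ae_eq.
  - exact: (bmfun_comp bh mg).
  - by apply: bmfunM; [exact: (bmfun_comp bf)|exact: bmfun_indic].
  - apply: filterS gK => x gx; congr (_ * _); rewrite !indicE; congr (_%:R).
    congr nat_of_bool; apply/idP/idP;
      by rewrite !inE /preimage/= -iterS iterSr gx.
apply: (@mulfI _ 2) => //.
rewrite Rintegral_branches// branch// branch//.
(* The induction hypothesis is used for [transfer f] in place of [f]. *)
rewrite iterSr -IH//; last 2 first.
- exact: bmfun_transfer.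
- by move=> x; rewrite /transfer divr_ge0// addr_ge0.
rewrite -RintegralD//; last 2 first.
- apply/bmfun_integrable/bmfunM; last exact: bmfun_indic.
  exact: (bmfun_comp bf).
- apply/bmfun_integrable/bmfunM; last exact: bmfun_indic.
  exact: (bmfun_comp bf).
rewrite -RintegralZl//; last first.
  apply: bmfun_integrable; apply: bmfunM; last exact: bmfun_indic.
  exact: bmfun_transfer.
by apply: eq_Rintegral => x _; rewrite /transfer; field.
Qed.

Lemma bmfun_iter_transfer n f : bmfun f -> bmfun (iter n transfer f).
Proof. by move=> bf; elim: n => //= n; exact: bmfun_transfer. Qed.

(** On X the iterate [u] stays within [e] of its value [c] at a base point. Hence the integral of
    [u] over B and P(B) times the integral of [u] are both within [e] of c P(B), which gives the
    factor 2. *)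
Lemma decorrelation K f B n : bmfun f -> (forall x, 0 <= f x) -> 0 <= K ->
  dlip dist K f -> measurable B ->
  `|\int[P]_x (f x * \1_(iter n F @^-1` B) x) - \int[P]_x f x * fine (P B)|
    <= 2 * (lam ^+ n * K * D).
Proof.
move=> bf f0 K0 fK mB; pose u := iter n transfer f.
have bu : bmfun u by exact: bmfun_iter_transfer.
(* Duality with the whole space for B: [transfer] preserves the integral. *)
have If : \int[P]_x f x = \int[P]_x u x.
  have indicTE (h : T -> R) : \int[P]_x (h x * \1_[set: T] x) = \int[P]_x h x.
    by apply: eq_Rintegral => x _; rewrite indicT mulr1.
  have := Rintegral_iter_transfer n bf f0 (@measurableT _ T).
  by rewrite preimage_setT !indicTE.
have [x0 Xx0] := X0; set c := u x0; set e := lam ^+ n * K * D.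
have ue x : X x -> `|u x - c| <= e.
  move=> Xx; apply: le_trans (dlip_iter_transfer n K0 fK x x0) _.
  apply: ler_wpM2l; last exact: distX.
  by rewrite mulr_ge0// exprn_ge0//; case/andP: lam01.
have e0 : 0 <= e by apply: le_trans (ue _ Xx0).
have buc : bmfun (fun x => u x - c) by apply: bmfunB => //; exact: bmfun_cst.
have b1 : bmfun (\1_B : T -> R) by exact: bmfun_indic.
have uB : `|\int[P]_x (u x * \1_B x) - c * fine (P B)| <= e.
  rewrite -Rintegral_indic// -RintegralZl//; last exact: bmfun_integrable.
  rewrite -RintegralB//; last 2 first.
  - exact/bmfun_integrable/bmfunM.
  - by apply/bmfun_integrable/bmfunM => //; exact: bmfun_cst.
  apply: Rintegral_ae_bound => //.
    by apply: bmfunB; apply: bmfunM => //; exact: bmfun_cst.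
  apply: filterS PX => x /ue; rewrite -mulrBl normrM indicE.
  by case: (x \in B); rewrite ?normr1 ?mulr1// normr0 mulr0.
have uT : `|\int[P]_x u x - c| <= e.
  rewrite -[X in _ - X](Rintegral_cst_probability P).
  rewrite -RintegralB//; last 2 first.
  - exact: bmfun_integrable.
  - exact/bmfun_integrable/bmfun_cst.
  by apply: Rintegral_ae_bound => //; apply: filterS PX => x /ue.
have PB0 : 0 <= fine (P B) by rewrite fine_ge0.
have PB1 : fine (P B) <= 1.
  rewrite -lee_fin fineK ?probability_le1//.
  by rewrite ge0_fin_numE//; apply: le_lt_trans (probability_le1 P mB) (ltry 1).
rewrite Rintegral_iter_transfer// If -/u.
rewrite (_ : _ - _ = (\int[P]_x (u x * \1_B x) - c * fine (P B))
  - (\int[P]_x u x - c) * fine (P B)); last ring.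
apply: le_trans (ler_normB _ _) _; rewrite mulr_natl mulr2n; apply: lerD => //.
rewrite normrM (ger0_norm PB0) -[leRHS]mulr1.
by apply: ler_pM.
Qed.

Lemma mixing_approximable A B : approximable P dist A -> measurable B ->
  P (A `&` iter n F @^-1` B) @[n --> \oo] --> (P A * P B)%E.
Proof.
move=> [mA aA] mB.
have Pfin C : measurable C -> P C \is a fin_num.
  move=> mC; rewrite ge0_fin_numE//.
  exact: le_lt_trans (probability_le1 P mC) (ltry 1).
have mI n : measurable (A `&` iter n F @^-1` B).
  by apply: measurableI => //; exact: measurable_iter_preimage.
rewrite -(fineK (Pfin A mA)) -(fineK (Pfin B mB)) -EFinM.
apply/fine_cvgP; split; first by apply: nearW => n; exact: Pfin.
apply/cvgrPdist_le => e e0.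
(* The error [e] is spent as e/4 for replacing the indicator of A by [f] in the correlation, e/2 for
   the decorrelation of [f], and e/4 for replacing P(A) by the integral of [f]. *)
have [f [mf f01 [K K0 fK] fe]] := aA (e / 4) ltac:(lra).
have bf : bmfun f by exact: bmfun_unit.
have f0 x : 0 <= f x by case/andP: (f01 x).
have bA : bmfun (\1_A : T -> R) by exact: bmfun_indic.
have cvg0 : (2 * (lam ^+ n * K * D)) @[n --> \oo] --> (0 : R).
  rewrite (_ : 0 = 2 * (0 * K * D)); last ring.
  apply: cvgMr; apply: cvgMl; apply: cvgMl; apply: cvg_expr.
  by case/andP: lam01 => l0 l1; rewrite ger0_norm.
have err C : measurable C ->
    `|\int[P]_x (f x * \1_C x) - fine (P (A `&` C))| <= e / 4.
  move=> mC; have bC : bmfun (\1_C : T -> R) by exact: bmfun_indic.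
  rewrite -Rintegral_indic; last exact: measurableI.
  have -> : \int[P]_x \1_(A `&` C) x = \int[P]_x (\1_A x * \1_C x) :> R.
    by apply: eq_Rintegral => x _; rewrite indicI.
  rewrite -RintegralB//; last 2 first.
  - exact/bmfun_integrable/bmfunM.
  - exact/bmfun_integrable/bmfunM.
  apply: le_trans (le_normr_Rintegral _ _) _ => //.
    by apply/bmfun_integrable/bmfunB; exact: bmfunM.
  apply: le_trans fe; apply: le_Rintegral => //.
  - by apply/bmfun_integrable/bmfun_norm/bmfunB; exact: bmfunM.
  - exact/bmfun_integrable/approximable_err.
  - move=> x _; rewrite -mulrBl normrM distrC [`|\1_C x|]ger0_norm ?indicE//.
    by rewrite ler_piMr//; case: (x \in C).
move/cvgrPdist_le : cvg0 => /(_ (e / 2) ltac:(lra)); apply: filterS => n.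
rewrite sub0r normrN => En.
have := decorrelation n bf f0 K0 fK mB.
have := err _ (measurable_iter_preimage n mB).
have := err _ (@measurableT _ T); rewrite setIT.
under eq_Rintegral do rewrite indicT mulr1.
have PB0 : 0 <= fine (P B) by rewrite fine_ge0.
have PB1 : fine (P B) <= 1 by rewrite -lee_fin fineK ?probability_le1 ?Pfin.
move: En => /(le_trans (ler_norm _)).
set I := \int[P]_x f x; set J := \int[P]_x _; set E := 2 * _.
set a := fine (P A); set b := fine (P B); set q := fine _ => Ee IA JA IJ.
rewrite (_ : _ - _ = a * b - q)//.
rewrite (_ : _ - _ = (J - q) - (J - I * b) - (I - a) * b); last ring.
apply: le_trans (ler_normB _ _) _.
have : `|J - q - (J - I * b)| <= e / 4 + e / 2.
  by apply: le_trans (ler_normB _ _) _; lra.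
have : `|(I - a) * b| <= e / 4 * 1.
  by rewrite normrM (ger0_norm PB0); apply: ler_pM.
lra.
Qed.

End two_branches.

(** * Lebesgue measure on the line under the affine maps of the branches *)

Section affine_lebesgue.
Context {R : realType}.
Notation mu := (@lebesgue_measure R).
Implicit Types A B : set (measurableTypeR R).

Let half_add (b : R) (t : measurableTypeR R) : measurableTypeR R := (t + b) / 2.

Let measurable_half_add b : measurable_fun setT (half_add b).
Proof. by apply: measurable_funM => //; exact: measurable_funD. Qed.

(** Half the image of Lebesgue measure under t -> (t + b) / 2 gives each interval ]u, v] its length,
    since the preimage is ]2u - b, 2v - b]; by uniqueness it is Lebesgue measure. *)
Lemma lebesgue_half_add (b : R) A : measurable A ->
  mu [set t : R | A ((t + b) / 2)] = (2%:E * mu A)%E.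
Proof.
move=> mA; have half0 : 0 <= 2^-1 :> R by rewrite invr_ge0.
pose nu0 : {measure set (measurableTypeR R) -> \bar R} :=
  measure_function_pushforward__canonical__measure_function_Measure mu
    (measurable_half_add b).
pose nu : {measure set (measurableTypeR R) -> \bar R} :=
  mscale (NngNum half0) nu0.
have -> : mu A = nu A.
  apply: lebesgue_measure_unique mA => _ [[u v]] _ <-.
  have -> : nu `]u, v]%classic%R =
      (2^-1%:E * mu `]2 * u - b, 2 * v - b]%classic%R)%E.
    congr (_ * mu _)%E; apply/seteqP; split=> t /=;
      by rewrite !in_itv/= /half_add => /andP[? ?]; lra.
  rewrite !lebesgue_measure_itv/= !lte_fin ltrD2r ltr_pM2l//.
  case: ifPn => _; last by rewrite mule0.
  by rewrite -!EFinD -EFinM; congr EFin; field.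
change (mu (half_add b @^-1` A) =
  (2%:E * (2^-1%:E * mu (half_add b @^-1` A)))%E).
by rewrite muleA -EFinM divff// mul1e.
Qed.

(** The case b = -1 of [lebesgue_half_add]: t lies in [-1, 1] exactly when (t - 1) / 2 lies in
    [-1, 0]. *)
Lemma lebesgue_left_branch A : measurable A ->
  mu ([set t : R | A ((t - 1) / 2)] `&` `[-1, 1]%classic%R) =
  (2%:E * mu (A `&` `[-1, 0]%classic%R))%E.
Proof.
move=> mA; rewrite -(lebesgue_half_add (-1)); last first.
  by apply: measurableI => //; exact: measurable_itv.
congr mu; apply/seteqP; split=> t /=; rewrite !in_itv/= => -[At /andP[? ?]];
  by split=> //; lra.
Qed.

(** The case b = 1 of [lebesgue_half_add], followed by the reflection t -> -t, which preserves
    Lebesgue measure. *)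
Lemma lebesgue_right_branch A : measurable A ->
  mu ([set t : R | A ((1 - t) / 2)] `&` `[-1, 1]%classic%R) =
  (2%:E * mu (A `&` `[0, 1]%classic%R))%E.
Proof.
move=> mA.
have mB : measurable (A `&` `[0, 1]%classic%R : set (measurableTypeR R)).
  by apply: measurableI => //; exact: measurable_itv.
rewrite -(lebesgue_half_add 1)// -[RHS]lebesgue_measureN.
  congr mu; apply/seteqP; split=> t /=; rewrite !in_itv/= addrC;
    move=> -[At /andP[? ?]];
    by split=> //; lra.
by rewrite -[X in measurable X]setTI; exact: measurable_half_add.
Qed.

Lemma lebesgue_setI_split A : measurable A ->
  mu (A `&` `[-1, 1]%classic%R) =
  (mu (A `&` `[-1, 0]%classic%R) + mu (A `&` `[0, 1]%classic%R))%E.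
Proof.
move=> mA.
have mI (a b : R) :
    measurable (A `&` `[a, b]%classic%R : set (measurableTypeR R)).
  by apply: measurableI => //; exact: measurable_itv.
have mI0 : measurable (A `&` `[-1, 0[%classic%R : set (measurableTypeR R)).
  by apply: measurableI => //; exact: measurable_itv.
(* The two closed halves share the null point 0; removing it from the left one makes the union
   disjoint. *)
have -> : mu (A `&` `[-1, 0]%classic%R) = mu (A `&` `[-1, 0[%classic%R).
  apply/eqP; rewrite eq_le; apply/andP; split; last first.
    apply: le_measure; rewrite ?inE//.
    by move=> t /=; rewrite !in_itv/= => -[At /andP[? ?]]; split=> //; lra.
  rewrite -[leRHS]adde0 -(lebesgue_measure_set1 (0 : R)).
  apply: le_trans (measureU2 _ _ _) => //.
  apply: le_measure; rewrite ?inE//; first exact: measurableU.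
  move=> t /=; rewrite !in_itv/= => -[At /andP[? ?]].
  by have [->|t0] := eqVneq t 0; [right|left; split=> //; lra].
rewrite -measureU//; last first.
  apply/seteqP; split=> // t /=; rewrite !in_itv/=.
  by move=> [[_ /andP[? ?]] [_ /andP[? ?]]]; lra.
congr mu; apply/seteqP; split=> t /=; rewrite !in_itv/=.
  move=> [At /andP[? ?]]; have [t0|t0] := ltP t 0; [left|right];
    by split=> //; lra.
by move=> [] [At /andP[? ?]]; split=> //; lra.
Qed.

End affine_lebesgue.

(** * Boxes and half-spaces as generators of the Borel sets of R^n *)

Section tuple_boxes.
Context {R : realType} {n : nat}.
Notation mR := (measurableTypeR R).

Definition box (A : 'I_n -> set mR) : set (Rtuple R n) :=
  [set x | forall i, A i (tnth x i)].

(** The pi-system on which two measures are compared in [measure_branches]. *)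
Definition boxes : set (set (Rtuple R n)) :=
  [set B | exists2 A : 'I_n -> set mR,
     (forall i, measurable (A i)) & B = box A].

Lemma measurable_box (A : 'I_n -> set mR) :
  (forall i, measurable (A i)) -> measurable (box A).
Proof.
move=> mA; rewrite (_ : box A =
    \bigcap_(i in [set: 'I_n]) (fun x => tnth x i) @^-1` A i).
  apply: fin_bigcap_measurable => // i _.
  by rewrite -[X in measurable X]setTI; exact: measurable_tnth.
by apply/seteqP; split=> x /= Ax i; [move=> _|]; exact: Ax.
Qed.

Lemma boxI (A B : 'I_n -> set mR) :
  box A `&` box B = box (fun i => A i `&` B i).
Proof.
apply/seteqP; split=> [x [Ax Bx] i|x ABx].
  by split; [exact: Ax|exact: Bx].
by split=> i; have [] := ABx i.
Qed.

Lemma setI_closed_boxes : setI_closed boxes.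
Proof.
move=> _ _ [A mA ->] [B mB ->]; exists (fun i => A i `&` B i); last exact: boxI.
by move=> i; exact: measurableI.
Qed.

Lemma measurable_tuple_sub (G : set (set (Rtuple R n))) :
  (forall i A, measurable A -> <<s G >> ((fun x => tnth x i) @^-1` A)) ->
  measurable `<=` <<s G >>.
Proof.
move=> Gi; apply: smallest_sub; first exact: smallest_sigma_algebra.
elim/big_ind : _ => //; first by move=> U V UG VG; rewrite subUset.
by move=> i _ _ [A mA <-]; rewrite setTI; exact: Gi.
Qed.

Lemma measurable_boxes : measurable = <<s boxes >>.
Proof.
apply/seteqP; split; last first.
  apply: smallest_sub; first exact: sigma_algebra_measurable.
  by move=> _ [A mA ->]; exact: measurable_box.
apply: measurable_tuple_sub => i A mA; apply: sub_sigma_algebra.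
(* A cylinder over coordinate [i] is a box whose other sides are the whole line. *)
exists (fun j => if j == i then A else setT).
  by move=> j; case: ifP.
apply/seteqP; split=> x /= Ax; first by move=> j; case: eqP => // ->.
by have := Ax i; rewrite eqxx.
Qed.

Lemma measurable_tuple_superlevel :
  measurable `<=`
    <<s [set [set x : Rtuple R n | c < (tnth x i : R)]
        | i in setT & c in [set: R]] >>.
Proof.
set G := (X in <<s X >>).
apply: measurable_tuple_sub => i A.
(* The sets whose [i]-th cylinder lies in the target form a sigma-algebra, so it is enough to check
   the rays ]c, +oo[, which generate the Borel sets of the line. *)
have : measurable `<=` image_set_system setT (fun x => tnth x i) <<s G >>.
  rewrite {1}/measurable/= RGenOInfty.measurableE.
  apply: smallest_sub.
    exact/sigma_algebra_image/smallest_sigma_algebra.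
  move=> _ [c ->]; rewrite /image_set_system /= setTI; apply: sub_sigma_algebra.
  exists i => //; exists c => //; apply/seteqP; split=> x /=;
    by rewrite in_itv/= andbT.
by move=> /[apply]; rewrite /image_set_system /= setTI.
Qed.

End tuple_boxes.

(** * The inverse branches of the twisted baker map, with M = N + 2 *)

Section baker_branches.
Context (R : realType) (N : nat).
Notation mR := (measurableTypeR R).
Notation T := (Rtuple R N.+2).
Notation F := (@twisted_baker R N.+2).
Notation P := (@baker_measure R N.+2).
Notation X := (@baker_space R N.+2).
Notation mu := (@lebesgue_measure R).

Definition left_branch (y : T) : T :=
  [tuple if i == ord0 then ((tnth y i : R) - 1) / 2 else tnth y i | i < N.+2].

(** [ordS] is the cyclic successor: coordinates shift down by one, and the last place receives
    coordinate 0, folded by the inverse of t -> 1 - 2t. *)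
Definition right_branch (y : T) : T :=
  [tuple if i == ord_max then (1 - (tnth y (ordS i) : R)) / 2
   else tnth y (ordS i) | i < N.+2].

Lemma tnth_left_branch y i : tnth (left_branch y) i =
  if i == ord0 then ((tnth y i : R) - 1) / 2 else tnth y i.
Proof. exact: tnth_mktuple. Qed.

Lemma tnth_right_branch y i : tnth (right_branch y) i =
  if i == ord_max then (1 - (tnth y (ordS i) : R)) / 2 else tnth y (ordS i).
Proof. exact: tnth_mktuple. Qed.

Lemma ordS_max n : ordS (@ord_max n) = ord0.
Proof. by apply: val_inj; rewrite /= modnn. Qed.

Lemma ordS_widen n (j : 'I_n.+1) :
  ordS (widen_ord (leqnSn n.+1) j) = lift ord0 j.
Proof. by apply: val_inj; rewrite /= modn_small// ltnS. Qed.

Lemma widen_ord_eq_max n (j : 'I_n.+1) :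
  (widen_ord (leqnSn n.+1) j == ord_max) = false.
Proof. by apply/negbTE; rewrite -val_eqE /= ltn_eqF. Qed.

Lemma measurable_left_branch : measurable_fun setT left_branch.
Proof.
apply/measurable_fun_tnthP => i; rewrite /comp/=.
under eq_fun do rewrite tnth_mktuple.
case: eqP => _; last exact: measurable_tnth.
apply: measurable_funM => //; apply: measurable_funB => //.
exact: measurable_tnth.
Qed.

Lemma measurable_right_branch : measurable_fun setT right_branch.
Proof.
apply/measurable_fun_tnthP => i; rewrite /comp/=.
under eq_fun do rewrite tnth_mktuple.
case: eqP => _; last exact: measurable_tnth.
apply: measurable_funM => //; apply: measurable_funB => //.
exact: measurable_tnth.
Qed.

Lemma nth_tnth (x : T) k (kN : (k < N.+2)%N) : x`_k = tnth x (Ordinal kN).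
Proof. by rewrite (tnth_nth 0). Qed.

Lemma measurable_twisted_baker : measurable_fun setT F.
Proof.
have mnth k : (k < N.+2)%N -> measurable_fun setT (fun x : T => x`_k : R).
  move=> kN; under eq_fun do rewrite (nth_tnth _ kN).
  exact: measurable_tnth.
apply: measurable_fun_ifT.
- by apply: measurable_fun_ltr => //; exact: mnth.
- apply/measurable_fun_tnthP => i; rewrite /comp/=.
  under eq_fun do rewrite tnth_mktuple.
  case: eqP => _; last exact: mnth.
  apply: measurable_funD => //; apply: measurable_funM => //.
  exact: mnth.
- apply/measurable_fun_tnthP => i; rewrite /comp/=.
  under eq_fun do rewrite tnth_mktuple.
  case: eqP => _; last by apply: mnth; exact: leq_ltn_trans (leq_pred _) _.
  apply: measurable_funB => //; apply: measurable_funM => //.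
  exact: mnth.
Qed.

(** The strict inequality matters: if the first coordinate of [y] is 1, that of [left_branch y] is
    0, where F follows its other formula. *)
Lemma left_branchK y : (tnth y ord0 : R) < 1 -> F (left_branch y) = y.
Proof.
move=> y1; have l0 : (left_branch y)`_0 = ((tnth y ord0 : R) - 1) / 2.
  by rewrite (nth_tnth _ (ltn0Sn _)) tnth_left_branch.
apply: eq_from_tnth => i; rewrite /twisted_baker l0 ifT; last by lra.
rewrite tnth_mktuple; case: (eqVneq (i : nat) 0%N) => i0.
  by rewrite (_ : i = ord0); [field|exact: val_inj].
rewrite (nth_tnth _ (ltn_ord i)) tnth_left_branch -val_eqE/= (negbTE i0).
by congr tnth; exact: val_inj.
Qed.

(** The first coordinate of [right_branch y] is the second one of [y], which is nonnegative on X, so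
    F follows its formula on X_R. *)
Lemma right_branchK y : X y -> F (right_branch y) = y.
Proof.
move=> Xy; have r0 : (right_branch y)`_0 = tnth y (lift ord0 ord0).
  rewrite (nth_tnth _ (ltn0Sn _)) tnth_right_branch.
  rewrite (_ : (_ == ord_max) = false)//.
  by congr tnth; apply: val_inj; rewrite /= modn_small.
have rmax : (right_branch y)`_N.+1 = (1 - (tnth y ord0 : R)) / 2.
  rewrite (nth_tnth _ (ltnSn _)) tnth_right_branch -val_eqE/= eqxx.
  rewrite -(ordS_max N.+1).
  by congr ((1 - tnth _ _) / 2); exact: val_inj.
have y1 : 0 <= (tnth y (lift ord0 ord0) : R).
  by have /andP[] := Xy (lift ord0 ord0).
apply: eq_from_tnth => i; rewrite /twisted_baker r0.
rewrite (_ : (_ < 0) = false) ?rmax; last by rewrite ltNge y1.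
rewrite tnth_mktuple; case: (eqVneq (i : nat) 0%N) => i0.
  by rewrite (_ : i = ord0); [field|exact: val_inj].
have iN : (i.-1 < N.+2)%N by exact: leq_ltn_trans (leq_pred _) _.
rewrite (nth_tnth _ iN) tnth_right_branch.
rewrite (_ : (_ == ord_max) = false); last first.
  by apply/negbTE; rewrite -val_eqE/= -eqSS prednK ?lt0n// ltn_eqF.
by congr tnth; apply: val_inj; rewrite /= prednK ?lt0n// modn_small.
Qed.

(** The weights grow with the index so that the shift in [right_branch] gains one unit of weight on
    every coordinate but the first; they stay below 2 M, so that moving the first coordinate to the
    last place is paid for by its halving. *)
Definition baker_dist (x y : T) : R :=
  \sum_(i < N.+2) (N.+2 + i)%:R * `|(tnth x i : R) - tnth y i|.

(** A coordinate of weight w other than the first contributes w + (w - 1) over the two branches, a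
    relative loss of 1 / (2 w) from 2 w, and this is at least 1 / (4 M) because w <= 2 M. *)
Definition baker_rate : R := 1 - (4 * N.+2%:R)^-1.

Lemma baker_rate01 : 0 <= baker_rate < 1.
Proof.
have : 1 <= N.+2%:R :> R by rewrite ler1n.
rewrite /baker_rate; move: (N.+2%:R : R) => m m1.
have i0 : 0 < (4 * m)^-1 by rewrite invr_gt0; lra.
have i1 : (4 * m)^-1 <= 1 by rewrite invf_le1; lra.
lra.
Qed.

(** Coefficients are compared coordinate by coordinate. The first one gets M / 2 + (2 M - 1) / 2,
    below the allowed 2 M - 1 / 2; the others are the sums [S'] and [S], whose weights differ by
    one. *)
Lemma baker_dist_contract x y :
  baker_dist (left_branch x) (left_branch y) +
  baker_dist (right_branch x) (right_branch y) <=
  2 * baker_rate * baker_dist x y.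
Proof.
have half (u v : R) : `|u / 2 - v / 2| = `|u - v| / 2.
  by rewrite -mulrBl normrM (@ger0_norm _ 2^-1)// invr_ge0.
have Ml : baker_dist (left_branch x) (left_branch y) =
    N.+2%:R * (`|(tnth x ord0 : R) - tnth y ord0| / 2) +
    \sum_(j < N.+1) (N.+2 + j.+1)%:R *
      `|(tnth x (lift ord0 j) : R) - tnth y (lift ord0 j)|.
  rewrite /baker_dist big_ord_recl addn0 !tnth_left_branch eqxx half.
  rewrite opprB addrA subrK.
  by congr (_ + _); apply: eq_bigr => j _; rewrite !tnth_left_branch.
have Mr : baker_dist (right_branch x) (right_branch y) =
    \sum_(j < N.+1) (N.+2 + j)%:R *
      `|(tnth x (lift ord0 j) : R) - tnth y (lift ord0 j)| +
    (N.+2 + N.+1)%:R * (`|(tnth x ord0 : R) - tnth y ord0| / 2).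
  rewrite /baker_dist big_ord_recr !tnth_right_branch eqxx half ordS_max.
  congr (_ + _).
    apply: eq_bigr => j _.
    by rewrite !tnth_right_branch widen_ord_eq_max ordS_widen.
  by congr (_ * (_ / 2)); rewrite distrC; congr (`|_|); ring.
have Md : baker_dist x y = N.+2%:R * `|(tnth x ord0 : R) - tnth y ord0| +
    \sum_(j < N.+1) (N.+2 + j.+1)%:R *
      `|(tnth x (lift ord0 j) : R) - tnth y (lift ord0 j)|.
  by rewrite /baker_dist big_ord_recl addn0.
rewrite Ml Mr Md {Ml Mr Md}.
have := normr_ge0 ((tnth x ord0 : R) - tnth y ord0).
move: `|(tnth x ord0 : R) - tnth y ord0| => a a0.
set S' := \sum_(j < N.+1) (N.+2 + j.+1)%:R * _.
set S := \sum_(j < N.+1) (N.+2 + j)%:R * _.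
have M0 : 0 < N.+2%:R :> R by rewrite ltr0n.
have rateM : 2 * baker_rate * N.+2%:R = 2 * N.+2%:R - 2^-1.
  by rewrite /baker_rate; field; rewrite gt_eqF.
have SS : S' + S <= 2 * baker_rate * S'.
  rewrite /S /S' -big_split mulr_sumr; apply: ler_sum => j _ /=.
  rewrite -mulrDl mulrA; apply: ler_wpM2r => //.
  have jM : (N.+2 + j.+1)%:R <= 2 * N.+2%:R :> R.
    by rewrite -natrM ler_nat mul2n -addnn leq_add2l ltnW// ltnS.
  have jE : (N.+2 + j.+1)%:R = (N.+2 + j)%:R + 1 :> R by rewrite addnS natr1.
  have : (N.+2 + j.+1)%:R / (4 * N.+2%:R) <= 2^-1 :> R.
    by rewrite ler_pdivrMr; lra.
  move: jE; rewrite /baker_rate; move: (_%:R) (_%:R) (_^-1) => w v q jE vq.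
  by rewrite (_ : 2 * (1 - q) * v = 2 * v - 2 * (v * q)); [lra|ring].
have lastE : (N.+2 + N.+1)%:R = 2 * N.+2%:R - 1 :> R.
  by rewrite -natrM mul2n -addnn [in RHS]addnS -[in RHS]natr1 addrK.
have aM : 0 <= a * N.+2%:R by rewrite mulr_ge0// ltW.
rewrite {}lastE; move: M0 rateM SS aM.
move: (N.+2%:R : R) S S' baker_rate => c S S' r c0 rc SS ac.
rewrite (_ : 2 * r * (c * a + S') = (2 * r * c) * a + 2 * r * S'); last ring.
by rewrite rc; lra.
Qed.

Lemma measure_box (A : 'I_N.+2 -> set mR) : (forall i, measurable (A i)) ->
  P (box A) = (mu (A ord0 `&` `[-1, 1]%classic%R) *
    \prod_(j < N.+1) mu (A (lift ord0 j) `&` `[0, 1]%classic%R) * 2^-1%:E)%E.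
Proof.
move=> mA.
pose side (i : 'I_N.+2) : set mR :=
  `[(if i == 0%N :> nat then -1 else 0 : R), 1]%classic.
have XE : X = box side.
  by apply/seteqP; split=> x /= Xx i; have := Xx i; rewrite /side /= in_itv.
rewrite baker_measureE// XE boxI lebesgue_tuple_box; last first.
  by move=> i; apply: measurableI => //; exact: measurable_itv.
by rewrite big_ord_recl.
Qed.

Lemma ae_imp2 d (U : measurableType d) (Q : probability U R)
    (A B C : U -> Prop) :
  {ae Q, forall x, A x} -> {ae Q, forall x, B x} ->
  (forall x, A x -> B x -> C x) -> {ae Q, forall x, C x}.
Proof. by move=> QA QB ABC; apply: filterS2 ABC QA QB. Qed.

Lemma ae_baker_space : {ae P, forall x, X x}.
Proof.
exists (~` X); split.
- by apply: measurableC; exact: measurable_baker_space.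
- by rewrite baker_measureE// setICl measure0 mul0e.
- by [].
Qed.

Lemma ae_left_branchK : {ae P, forall x, F (left_branch x) = x}.
Proof.
have : {ae P, forall x, (tnth x ord0 : R) != 1}.
  (* The exceptional hyperplane is a box with side {1} in the first coordinate, so its measure has a
     zero factor. *)
  pose A (i : 'I_N.+2) : set mR := if i == ord0 then [set 1] else setT.
  have mA i : measurable (A i).
    by rewrite /A; case: ifP => // _; exact: measurable_set1.
  exists (box A); split; first exact: measurable_box.
  - rewrite measure_box// (_ : mu _ = 0) ?mul0e//.
    apply/eqP; rewrite -measure_le0 -(lebesgue_measure_set1 (1 : R)) /A eqxx.
    apply: le_measure; rewrite ?inE//.
    by apply: measurableI => //; exact: measurable_itv.
  - move=> x /= x1 i; rewrite /A.
    have /eqP {}x1 : (tnth x ord0 : R) == 1 by apply: contrapT => /negP.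
    by case: eqP => // ->.
move=> x1; apply: (ae_imp2 x1 ae_baker_space) => x {}x1 Xx.
by apply: left_branchK; rewrite lt_neqAle x1; have /andP[] := Xx ord0.
Qed.

Lemma ae_right_branchK : {ae P, forall x, F (right_branch x) = x}.
Proof.
by apply: (ae_imp2 ae_baker_space ae_baker_space) => x _; exact: right_branchK.
Qed.

(** Both sides are finite measures, so boxes suffice. There the left branch accounts for the part of
    the first side in [-1, 0] and the right branch for the part in [0, 1], each doubled by its
    affine factor. *)
Lemma measure_branches (A : set T) : measurable A ->
  (2%:E * P A = P (left_branch @^-1` A) + P (right_branch @^-1` A))%E.
Proof.
move=> mA.
pose P2 : {measure set T -> \bar R} := mscale (NngNum (ler0n R 2)) P.
pose P0 : {measure set T -> \bar R} :=
  measure_function_pushforward__canonical__measure_function_Measure P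
    measurable_left_branch.
pose P1 : {measure set T -> \bar R} :=
  measure_function_pushforward__canonical__measure_function_Measure P
    measurable_right_branch.
apply: etrans (measure_addE P0 P1 A).
apply: (measure_unique boxes (fun=> setT) measurable_boxes setI_closed_boxes
  _ _ P2 (measure_add P0 P1) _ _ A mA).
- move=> _; exists (fun=> setT) => //; exact/seteqP.
- by rewrite bigcup_const//; exists 0%N.
- move=> _ [B mB ->]; apply: esym; apply: etrans (measure_addE P0 P1 _) _.
  apply: esym.
  change (2%:E * P (box B) =
    P (left_branch @^-1` box B) + P (right_branch @^-1` box B))%E.
  pose Bl (i : 'I_N.+2) := if i == ord0
    then [set t : mR | B i (((t : R) - 1) / 2)] else B i.
  (* The preimage of a box under [right_branch] is a box with cyclically shifted sides; the first
     one comes from the last side of [B]. *)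
  pose Br (i : 'I_N.+2) := if i == ord0
    then [set t : mR | B ord_max ((1 - (t : R)) / 2)] else B (ord_pred i).
  have mleft : measurable_fun [set: mR] (fun t : mR => ((t : R) - 1) / 2 : mR).
    by apply: measurable_funM => //; exact: measurable_funB.
  have mright : measurable_fun [set: mR] (fun t : mR => (1 - (t : R)) / 2 : mR).
    by apply: measurable_funM => //; exact: measurable_funB.
  have mBl i : measurable (Bl i).
    rewrite /Bl; case: ifP => _; last exact: mB.
    by rewrite -[X in measurable X]setTI; exact: mleft.
  have mBr i : measurable (Br i).
    rewrite /Br; case: ifP => _; last exact: mB.
    by rewrite -[X in measurable X]setTI; exact: mright.
  have -> : left_branch @^-1` box B = box Bl.
    apply/seteqP; split=> x /= Bx i; have := Bx i;
      by rewrite /Bl tnth_left_branch; case: eqP.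
  have -> : right_branch @^-1` box B = box Br.
    apply/seteqP; split=> x /= Bx i.
      have := Bx (ord_pred i); rewrite /Br tnth_right_branch ord_predK.
      rewrite -{1}(inj_eq (can_inj (@ordSK N.+2))) ord_predK ordS_max.
      case: eqP => // ->.
      by rewrite (_ : ord_pred ord0 = ord_max)// -ordS_max ordSK.
    have := Bx (ordS i); rewrite /Br tnth_right_branch ordSK.
    rewrite -ordS_max (inj_eq (can_inj (@ordSK N.+2))).
    by case: eqP => // ->.
  rewrite !measure_box// {1}/Bl {1}/Br !eqxx lebesgue_left_branch//.
  rewrite lebesgue_right_branch//.
  rewrite lebesgue_setI_split//.
  have two_half (z : \bar R) : (2%:E * (z * 2^-1%:E) = z)%E.
    by rewrite muleCA -EFinM divff// mule1.
  (* Both sides are the product of all the factors for B i cut by [0, 1], with the last factor split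
     off on the left and the first one on the right. *)
  have prodE : (mu (B ord_max `&` `[0, 1]%classic%R) *
      \prod_(j < N.+1) mu (Br (lift ord0 j) `&` `[0, 1]%classic%R) =
    mu (B ord0 `&` `[0, 1]%classic%R) *
      \prod_(j < N.+1) mu (B (lift ord0 j) `&` `[0, 1]%classic%R))%E.
    rewrite -(big_ord_recl N.+1 (fun i => mu (B i `&` `[0, 1]%classic%R)))%E.
    rewrite [RHS]big_ord_recr /= muleC; congr (_ * _)%E; apply: eq_bigr => j _.
    by rewrite /Br /= -ordS_widen ordSK.
  rewrite -(muleA 2%:E (mu (B ord_max `&` _))) prodE -!(muleA 2%:E) !two_half.
  by rewrite ge0_muleDl.
- move=> _; apply: (@le_lt_trans _ _ 2%:E); last exact: ltry.
  rewrite -[leRHS]mule1; apply: lee_pmul => //.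
  exact: probability_le1.
Qed.

Lemma baker_dist_le x y : X x -> X y ->
  baker_dist x y <= \sum_(i < N.+2) (N.+2 + i)%:R * 2.
Proof.
move=> Xx Xy; apply: ler_sum => i _; apply: ler_wpM2l => //.
have /andP[xi x1] := Xx i; have /andP[yi y1] := Xy i.
by rewrite ler_norml; move: xi yi; case: ifP => _; lra.
Qed.

(** Half-spaces are superlevel sets of coordinates, and each coordinate is 1-Lipschitz for
    [baker_dist] because all weights are at least 1. *)
Lemma baker_approximable A : measurable A -> approximable P baker_dist A.
Proof.
apply: (measurable_approximable (@measurable_tuple_superlevel R N.+2)).
move=> _ [i _ [c _ <-]].
apply: (approximable_superlevel P c (measurable_tnth i) ler01) => // x y.
rewrite mul1r /baker_dist (bigD1 i)//= -[leLHS]addr0; apply: lerD.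
  by rewrite ler_peMl// ler1n.
by apply: sumr_ge0 => j _; rewrite mulr_ge0.
Qed.

End baker_branches.

Theorem theoremD (R : realType) (M : nat) (hM : (2 <= M)%N) :
  mixing (@baker_space R M) (@baker_measure R M) (@twisted_baker R M).
Proof.
case: M hM => [|[|N]]// _ A B mA mB _ _.
have X0 : baker_space (R := R) (M := N.+2) !=set0.
  exists [tuple 0 | i < N.+2] => i; rewrite tnth_mktuple.
  by case: ifP => _; lra.
exact: (mixing_approximable (@measurable_twisted_baker R N)
  (@measurable_left_branch R N) (@measurable_right_branch R N)
  (@measure_branches R N) (@ae_left_branchK R N) (@ae_right_branchK R N)
  (@baker_rate01 R N) (@baker_dist_contract R N) (@ae_baker_space R N) X0
  (@baker_dist_le R N) (baker_approximable mA) mB).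
Qed.
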